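(* (Myhill, Shepherdson) Let $A\subseteq\omega$ be an infinite c.e. set, $m,n\ge1$, and for every $i\ge1$ let $\theta^{(i)}$ be a quasi-Gödel numbering of $\mathcal S^{(i)}_A$ (with respect to which Markov-computability is understood). (1) The restriction to $\mathcal S^{(n)}_A$ of every computable operator $\widehat G:\widehat{\mathcal S}^{(n)}_A\to\widehat{\mathcal S}^{(m)}_A$ is Markov-computable. (2) Every Markov-computable operator $G:\mathcal S^{(n)}_A\to\mathcal S^{(m)}_A$ is the restriction to $\mathcal S^{(n)}_A$ of a computable operator $\widehat G:\widehat{\mathcal S}^{(n)}_A\to\widehat{\mathcal S}^{(m)}_A$.
   Context: $\omega$ is the set of natural numbers; $\mathcal F^{(n)}$ and $\mathcal R^{(n)}$ are the sets of all total, respectively all total computable, functions $\omega^n\to\omega$. $\langle\cdot,\cdot\rangle:\omega^2\to\omega$ is a computable bijection with $\langle x,y\rangle\ge x,y$, extended by $\langle x\rangle=x$, $\langle x_1,\dots,x_{n+1}\rangle=\langle x_1,\langle x_2,\dots,x_{n+1}\rangle\rangle$. $\mathrm{Anf}^{(n)}_A$ is the set of partial functions from $\omega^n$ to $\omega$ whose domain is either empty or equal to $\{0,\dots,a-1\}^n$ for some $a\in A$; $\mathcal S^{(n)}_A=\mathcal R^{(n)}\cup\mathrm{Anf}^{(n)}_A$ and $\widehat{\mathcal S}^{(n)}_A=\mathcal F^{(n)}\cup\mathrm{Anf}^{(n)}_A$. For an $n$-ary partial function $q$, $\mathrm{graph}(q)=\{\langle\langle\vec x\rangle,q(\vec x)\rangle:\vec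 x\in\mathrm{dom}(q)\}$, and the extended graph of $q$ is $\{\langle\langle\vec y\rangle,0\rangle:\vec y\in\omega^n\}\cup\{\langle\langle\vec x\rangle,q(\vec x)+1\rangle:\vec x\in\mathrm{dom}(q)\}$. A numbering of a set $X$ is a surjection $\omega\to X$. A numbering $\theta$ of $\mathcal S^{(n)}_A$ is a quasi-Gödel numbering if: (QGN I) the extended graph of $(i,\vec x)\mapsto\theta_i(\vec x)$ is the range of a function in $\mathcal R^{(1)}$; and (QGN II) for every $k\in\mathcal R^{(2)}$ there is $v\in\mathcal R^{(1)}$ such that for all $i\in\omega$, $r\in\mathcal S^{(n)}_A$: if $\{k(i,t):t\in\omega\}$ is the extended graph of $r$, then $r=\theta_{v(i)}$. Fix an effective bijective coding of finite sequences of natural numbers by natural numbers. An operator $\widehat G:\widehat{\mathcal S}^{(n)}_A\to\widehat{\mathcal S}^{(m)}_A$ is computable if there is a c.e. set $C\subseteq\omega$ such that for all $r\in\widehat{\mathcal S}^{(n)}_A$, $\mathrm{graph}(\widehat G(r))$ is the set of all $\langle\langle\vec y\rangle,z\rangle$ for which there is $a\in\omega$ with $\langle\langle\langle\vec y\rangle,z\rangle,a\rangle\in C$ such that every entry of the finite sequence coded by $a$ belongs to $\mathrm{graph}(r)$. An operator $G:\mathcal S^{(n)}_A\to\mathcal S^{(m)}_A$ is Markov-computable if there is $g\in\mathcal R^{(1)}$ with $G(\theta^{(n)}_i)=\theta^{(m)}_{g(i)}$ for all $i\in\omega$. *)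

(* Defs.v *)
From mathcomp Require Import all_boot.
From mathcomp Require Import boolp classical_sets functions cardinality.
Set Implicit Arguments.
Unset Strict Implicit.
Unset Printing Implicit Defensive.

Local Open Scope classical_set_scope.

Inductive recf : nat -> Type :=
| Zero n : recf n
| Succ : recf 1
| Proj n (i : 'I_n) : recf n
| Comp k n (f : recf k) (g : 'I_k -> recf n) : recf n
| Prec n (f : recf n) (g : recf n.+2) : recf n.+1
| Mu n (f : recf n.+1) : recf n.

(* [eval c v y]: the partial recursive function with program [c] is defined at
   [v] with value [y].  In [Prec] the recursion variable comes first and [s]
   lists the intermediate values; in [Mu] the minimised variable comes first,
   and all values before the least zero must be defined. *)
Fixpoint eval n (c : recf n) : n.-tuple nat -> nat -> Prop :=
  match c in recf n return n.-tuple nat -> nat -> Prop with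
  | Zero _ => fun _ y => y = 0
  | Succ => fun v y => y = (thead v).+1
  | Proj _ i => fun v y => y = tnth v i
  | Comp k _ f g => fun v y =>
      exists w : k.-tuple nat, (forall i, eval (g i) v (tnth w i)) /\ eval f w y
  | Prec _ f g => fun v y =>
      exists s : nat -> nat,
        [/\ eval f [tuple of behead v] (s 0),
            forall k, k < thead v ->
              eval g [tuple of k :: s k :: behead v] (s k.+1)
          & y = s (thead v)]
  | Mu _ f => fun v y =>
      eval f [tuple of y :: v] 0 /\
      forall k, k < y -> exists z, eval f [tuple of k :: v] z.+1
  end.

Definition computable n (f : n.-tuple nat -> nat) : Prop :=
  exists c : recf n, forall v, eval c v (f v).

Definition computable1 (f : nat -> nat) : Prop :=
  computable (fun v : 1.-tuple nat => f (tnth v ord0)).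

Definition computable2 (f : nat -> nat -> nat) : Prop :=
  computable (fun v : 2.-tuple nat => f (tnth v ord0) (tnth v ord_max)).

Definition ce (A : set nat) : Prop :=
  A = set0 \/ exists2 f, computable1 f & range f = A.

Definition pairing (pr : nat -> nat -> nat) : Prop :=
  [/\ computable2 pr,
      bijective (fun p : nat * nat => pr p.1 p.2)
    & forall x y, x <= pr x y /\ y <= pr x y].

(* Only meant for nonempty sequences; the value on [::] is irrelevant. *)
Fixpoint tuple_code (pr : nat -> nat -> nat) (s : seq nat) : nat :=
  match s with
  | [::] => 0
  | [:: x] => x
  | x :: s' => pr x (tuple_code pr s')
  end.

(* A coding of finite sequences is given by its decoding function.
   Effectiveness: length and entries are computable from the code, and codes
   can be computed by starting from the code of the empty sequence. *)
Definition effective_coding (dec : nat -> seq nat) : Prop :=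
  [/\ bijective dec,
      computable1 (fun a => size (dec a)),
      computable2 (fun a i => nth 0 (dec a) i)
    & exists2 c, computable2 c & forall x a, dec (c x a) = x :: dec a].

Definition pfun (n : nat) : Type := n.-tuple nat -> option nat.

Definition dom n (q : pfun n) : set (n.-tuple nat) := [set x | q x <> None].

Definition Ftot n : set (pfun n) := [set q | exists f, q = Some \o f].
Arguments Ftot : clear implicits.

Definition Rtot n : set (pfun n) :=
  [set q | exists2 f, computable f & q = Some \o f].
Arguments Rtot : clear implicits.

Definition Anf (A : set nat) n : set (pfun n) :=
  [set q | dom q = set0 \/
    exists2 a, A a & dom q = [set x | forall i, tnth x i < a]].
Arguments Anf : clear implicits.

Definition Sset (A : set nat) n : set (pfun n) := Rtot n `|` Anf A n.
Arguments Sset : clear implicits.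

Definition Shat (A : set nat) n : set (pfun n) := Ftot n `|` Anf A n.
Arguments Shat : clear implicits.

Definition graph (pr : nat -> nat -> nat) n (q : pfun n) : set nat :=
  [set w | exists x y, q x = Some y /\ w = pr (tuple_code pr x) y].

Definition egraph (pr : nat -> nat -> nat) n (q : pfun n) : set nat :=
  [set w | exists y : n.-tuple nat, w = pr (tuple_code pr y) 0] `|`
  [set w | exists x y, q x = Some y /\ w = pr (tuple_code pr x) y.+1].

Definition universal n (theta : nat -> pfun n) : pfun n.+1 :=
  fun v => theta (thead v) [tuple of behead v].

Definition QGN1 pr n (theta : nat -> pfun n) : Prop :=
  exists2 h, computable1 h & range h = egraph pr (universal theta).

Definition QGN2 pr (A : set nat) n (theta : nat -> pfun n) : Prop :=
  forall k, computable2 k ->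
  exists2 v, computable1 v &
    forall i r, Sset A n r -> range (k i) = egraph pr r -> r = theta (v i).

Definition quasi_Goedel_numbering pr (A : set nat) n (theta : nat -> pfun n) :
    Prop :=
  [/\ range theta = Sset A n, QGN1 pr theta & QGN2 pr A theta].

(* Operators are functions on all partial functions; only their values on
   [Shat A n], respectively [Sset A n], are relevant. *)
Definition computable_operator pr (dec : nat -> seq nat) (A : set nat) n m
    (G : pfun n -> pfun m) : Prop :=
  exists2 C, ce C &
    forall r, Shat A n r ->
      graph pr (G r) =
      [set w | exists (y : m.-tuple nat) z,
         w = pr (tuple_code pr y) z /\
         exists a, C (pr (pr (tuple_code pr y) z) a) /\
                   forall u, u \in dec a -> graph pr r u].

Definition Markov_computable n m (thetan : nat -> pfun n)
    (thetam : nat -> pfun m) (G : pfun n -> pfun m) : Prop :=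
  exists2 g, computable1 g & forall i, G (thetan i) = thetam (g i).

(* Main.v *)
Require Import Defs.
From mathcomp Require Import all_boot.
From mathcomp Require Import boolp classical_sets functions cardinality.

(* No universal program is needed: (QGN I) and (QGN II) say that the index [i]
   and a Sigma_1 presentation of the graph of [theta_i] can be computed from
   each other, and diagonalizing against [theta^(1)] yields a c.e. set
   [K = {i | exists t, T i t}] whose complement is not c.e.

   (1) A computable operator transforms presentations of graphs.

   (2) Suppose [G r y = z] for a Markov-computable [G].  If the presentation of
   [phi_i] depends computably on [i] and [phi_i = r] for all [i] outside [K],
   then [G phi_i y = z] for some [i] in [K], since otherwise the complement of
   [K] would be c.e.  Choosing [phi_i = s] on [K], where [s] extends [r], shows
   that [G] is monotone.  If [r] is total, choosing for [phi_i] on [K] the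
   restriction of [r] to a cube of side [a], where [a] in [A] exceeds the stage
   at which [i] enters [K], shows that [G r y = z] is already enforced by a
   finite [p] below [r].  Hence [G] is determined by its values at finite
   functions, which also define the extension. *)

Set Implicit Arguments.
Unset Strict Implicit.
Unset Printing Implicit Defensive.

Local Open Scope classical_set_scope.

(** * Closure properties of computable functions over environments *)

(* A type of environments, i.e. of tuples of variables; in [prod_ctx] the last
   variable bound comes first in the tuple, as in [Prec] and [Mu]. *)
Structure ctx := Ctx {
  ctx_sort :> Type;
  ctx_dim : nat;
  ctx_tuple : ctx_sort -> ctx_dim.-tuple nat;
  ctx_tuple_bij : bijective ctx_tuple }.

Canonical tuple_ctx n :=
  @Ctx (n.-tuple nat) n id (Bijective (fun _ => erefl) (fun _ => erefl)).

Fact nat_ctx_bij : bijective (fun x : nat => [tuple x]).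
Proof.
exists (fun v => thead v) => [x|v]; first by rewrite theadE.
by case/tupleP: v => x v; rewrite theadE (tuple0 v); exact/val_inj.
Qed.

Canonical nat_ctx := Ctx nat_ctx_bij.

Fact prod_ctx_bij (T : ctx) :
  bijective (fun q : T * nat => [tuple of q.2 :: ctx_tuple q.1]).
Proof.
have [g gK Kg] := ctx_tuple_bij T.
exists (fun v : (ctx_dim T).+1.-tuple nat => (g [tuple of behead v], thead v))
  => [[c x]|v] /=.
  by congr (_, _); rewrite ?theadE // -[RHS]gK; congr g; exact/val_inj.
by rewrite [RHS]tuple_eta; apply: val_inj; rewrite /= Kg.
Qed.

Canonical prod_ctx (T : ctx) := Ctx (prod_ctx_bij T).

Definition CF (T : ctx) (F : T -> nat) : Prop :=
  exists2 f, computable f & forall c, F c = f (ctx_tuple c).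

Definition cf1 f := CF (fun x : nat => f x).
Definition cf2 f := CF (fun q : nat * nat => f q.1 q.2).
Definition cf3 f := CF (fun q : nat * nat * nat => f q.1.1 q.1.2 q.2).
Definition cp1 P := cf1 (fun x => nat_of_bool (P x)).
Definition cp2 P := cf2 (fun x y => nat_of_bool (P x y)).
Definition cp3 P := cf3 (fun x y z => nat_of_bool (P x y z)).

Lemma CF_tuple n (f : n.-tuple nat -> nat) : CF f <-> computable f.
Proof.
split=> [[g gc fg]|fc]; last by exists f.
by have -> : f = g by apply/funext.
Qed.

Lemma computable_comp k n (f : k.-tuple nat -> nat)
    (s : n.-tuple nat -> k.-tuple nat) :
  computable f -> (forall i, computable (fun v => tnth (s v) i)) ->
  computable (f \o s).
Proof.
move=> [cf hf] /choice[cs hs]; exists (Comp cf cs) => v /=.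
by exists (s v).
Qed.

Section Closure.
Variable T : ctx.
Implicit Types F N : T -> nat.

Lemma CF_comp k (f : k.-tuple nat -> nat) (s : T -> k.-tuple nat) :
  computable f -> (forall i, CF (fun c => tnth (s c) i)) -> CF (f \o s).
Proof.
move=> fc hs.
have /choice[g hg] : forall i, exists g,
  computable g /\ forall c : T, tnth (s c) i = g (ctx_tuple c).
  by move=> i; have [g] := hs i; exists g.
exists (f \o (fun v => [tuple g i v | i < k])).
  apply: computable_comp => // i.
  under eq_fun do rewrite tnth_mktuple.
  by have [] := hg i.
move=> c /=; congr f; apply: eq_from_tnth => i.
by rewrite tnth_mktuple; have [_ ->] := hg i.
Qed.

Lemma CF_fst F : CF F -> CF (fun q : T * nat => F q.1).
Proof.
move=> [f fc Ff].
exists (fun v : (ctx_dim T).+1.-tuple nat => f [tuple of behead v]).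
  apply: (computable_comp (s := fun v : (ctx_dim T).+1.-tuple nat =>
    [tuple of behead v])) => // i.
  exists (Proj (lift ord0 i)) => v /=; rewrite tnth_behead; congr tnth.
  by apply: val_inj; rewrite /= inordK ?ltnS.
move=> [c x] /=; rewrite Ff; congr f; exact/val_inj.
Qed.

Lemma CF_snd : CF (fun q : T * nat => q.2).
Proof.
exists (fun v => tnth v ord0); first by exists (Proj ord0).
by case.
Qed.

Lemma CF_zero : CF (fun _ : T => 0).
Proof. by exists (fun=> 0) => //; exists (Zero _). Qed.

Lemma CF_app1 f F : cf1 f -> CF F -> CF (fun c => f (F c)).
Proof.
move=> [g gc fg] Fc.
have -> : (fun c => f (F c)) = g \o (fun c => [tuple F c]).
  by apply/funext => c; rewrite fg.
by apply: CF_comp => // i; under eq_fun do rewrite [i]ord1.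
Qed.

Lemma CF_app2 f F F' : cf2 f -> CF F -> CF F' -> CF (fun c => f (F c) (F' c)).
Proof.
move=> [g gc fg] Fc Fc'.
have -> : (fun c => f (F c) (F' c)) = g \o (fun c => [tuple F' c; F c]).
  apply/funext => c /=; rewrite (fg (F c, F' c)); congr g; exact/val_inj.
apply: CF_comp => // i; case: i => [[|[|//]] Hi] /=;
  by under eq_fun do rewrite (tnth_nth 0) /=.
Qed.

(** The environment of [S] binds the accumulated value before the counter, because [Prec] expects
    the counter first in its tuple. *)
Lemma CF_rec F N (S : T -> nat -> nat -> nat) :
  CF F -> CF N -> CF (fun q : T * nat * nat => S q.1.1 q.2 q.1.2) ->
  CF (fun c => nat_rect (fun=> nat) (F c) (S c) (N c)).
Proof.
move=> [f [cf fc] Ff] Nc [g [cg gc] Sg].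
pose h (v : (ctx_dim T).+1.-tuple nat) :=
  nat_rect (fun=> nat) (f [tuple of behead v])
   (fun k a => g [tuple of k :: a :: behead v]) (thead v).
have -> : (fun c => nat_rect (fun=> nat) (F c) (S c) (N c)) =
    h \o (fun c => [tuple of N c :: ctx_tuple c]).
  apply/funext => c /=; rewrite /h theadE.
  have eqb : [tuple of behead [tuple of N c :: ctx_tuple c]] = ctx_tuple c.
    exact/val_inj.
  rewrite eqb -Ff; set g' := fun k a => g _.
  have -> : S c = g'.
    apply/funext => k; apply/funext => a; rewrite (Sg (c, a, k)) /g'.
    by congr g; exact/val_inj.
  by [].
apply: CF_comp.
  exists (Prec cf cg) => v /=.
  exists (fun k => nat_rect (fun=> nat) (f [tuple of behead v])
   (fun k a => g [tuple of k :: a :: behead v]) k); split => //.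
move=> i; case: (unliftP ord0 i) => [j ->|->].
  exists (fun v => tnth v j); first by exists (Proj j).
  by move=> c; rewrite tnthS.
by have [g' g'c N'] := Nc; exists g'.
Qed.

Lemma CF_app3 f F F' F'' : cf3 f ->
  CF F -> CF F' -> CF F'' -> CF (fun c => f (F c) (F' c) (F'' c)).
Proof.
move=> [g gc fg] Fc Fc' Fc''.
have -> : (fun c => f (F c) (F' c) (F'' c)) =
    g \o (fun c => [tuple F'' c; F' c; F c]).
  apply/funext => c /=; rewrite (fg (F c, F' c, F'' c)).
  by congr g; exact/val_inj.
apply: CF_comp => // i; case: i => [[|[|[|//]]] Hi] /=;
  by under eq_fun do rewrite (tnth_nth 0) /=.
Qed.

Lemma CF_succ F : CF F -> CF (fun c => (F c).+1).
Proof.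
apply: CF_app1; exists (fun v => (thead v).+1); first by exists Succ.
by move=> x; rewrite theadE.
Qed.

Lemma CF_const k : CF (fun _ : T => k).
Proof. by elim: k => [|k IH]; [exact: CF_zero|exact: CF_succ]. Qed.

End Closure.

Arguments CF_snd {T}.
Arguments CF_const {T} k.

(** A case distinction is a primitive recursion of length 0 or 1. *)
Lemma CF_if (T : ctx) (P : T -> bool) (F N : T -> nat) :
  CF (fun c => nat_of_bool (P c)) ->
  CF F -> CF N -> CF (fun c => if P c then F c else N c).
Proof.
move=> Pc Fc Nc.
have -> : (fun c => if P c then F c else N c) =
    fun c => nat_rect (fun=> nat) (N c) (fun _ _ => F c) (P c).
  by apply/funext => c; case: (P c).
exact: (CF_rec (S := fun c _ _ => F c) Nc Pc (CF_fst (CF_fst Fc))).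
Qed.

Lemma CF_ex_minn (T : ctx) (P : T -> pred nat)
    (exP : forall c, exists y, P c y) :
  CF (fun q : T * nat => nat_of_bool (P q.1 q.2)) ->
  CF (fun c => ex_minn (exP c)).
Proof.
move=> Pc; have [g gK Kg] := ctx_tuple_bij T.
(* [Mu] searches for a zero, so truth is coded by [0] and falsity by [1]. *)
have := CF_if Pc (CF_const 0) (CF_const 1).
move=> [f [cf fc] Pf].
exists (fun v => ex_minn (exP (g v))) => [|c]; last by rewrite gK.
exists (Mu cf) => v /=; case: ex_minnP => y Py ymin; split=> [|k ky].
  by have := fc [tuple of y :: v]; have := Pf (g v, y); rewrite /= Kg Py => <-.
exists 0; have := fc [tuple of k :: v]; have := Pf (g v, k); rewrite /= Kg.
by case: ifP => [/ymin|_ <- //]; rewrite leqNgt ky.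
Qed.

Lemma CF_not (T : ctx) (P : T -> bool) :
  CF (fun c => nat_of_bool (P c)) -> CF (fun c => nat_of_bool (~~ P c)).
Proof.
move=> Pc; have := CF_if Pc (CF_const 0) (CF_const 1).
by congr (CF _); apply/funext => c; case: (P c).
Qed.

Lemma CF_and (T : ctx) (P Q : T -> bool) :
  CF (fun c => nat_of_bool (P c)) -> CF (fun c => nat_of_bool (Q c)) ->
  CF (fun c => nat_of_bool (P c && Q c)).
Proof.
move=> Pc Qc; have := CF_if Pc Qc (CF_const 0).
suff -> : (fun c => nat_of_bool (P c && Q c)) =
  fun c => if P c then nat_of_bool (Q c) else 0 by [].
by apply/funext => c; case: (P c).
Qed.

Lemma CF_or (T : ctx) (P Q : T -> bool) :
  CF (fun c => nat_of_bool (P c)) -> CF (fun c => nat_of_bool (Q c)) ->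
  CF (fun c => nat_of_bool (P c || Q c)).
Proof.
move=> Pc Qc; have := CF_not (CF_and (CF_not Pc) (CF_not Qc)).
by under eq_fun do rewrite negb_and !negbK.
Qed.

Lemma CF_pred (T : ctx) (F : T -> nat) : CF F -> CF (fun c => (F c).-1).
Proof.
move=> Fc; have := CF_rec (S := fun _ k _ => k) (CF_const 0) Fc CF_snd.
by congr (CF _); apply/funext => c; case: (F c).
Qed.

Lemma CF_leq (T : ctx) (F N : T -> nat) :
  CF F -> CF N -> CF (fun c => nat_of_bool (F c <= N c)).
Proof.
move=> Fc Nc.
(* Iterating the predecessor gives truncated subtraction; a second recursion tests whether the
   result is [0]. *)
have sc := CF_rec (S := fun _ _ a => a.-1) Fc Nc
  (CF_pred (CF_fst CF_snd)).
have := CF_rec (S := fun _ _ _ => 0) (CF_const 1) sc (CF_const 0).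
congr (CF _); apply/funext => c; rewrite /leq.
suff -> : nat_rect (fun=> nat) (F c) (fun _ a => a.-1) (N c) = F c - N c.
  by case: (F c - N c).
by elim: (N c) => [|k IH] /=; rewrite ?subn0 // IH subnS.
Qed.

Lemma CF_eq (T : ctx) (F N : T -> nat) :
  CF F -> CF N -> CF (fun c => nat_of_bool (F c == N c)).
Proof.
move=> Fc Nc; have := CF_and (CF_leq Fc Nc) (CF_leq Nc Fc).
by under eq_fun do rewrite -eqn_leq.
Qed.

Lemma CF_all (T : ctx) (P : T -> pred nat) (N : T -> nat) :
  CF (fun q : T * nat => nat_of_bool (P q.1 q.2)) -> CF N ->
  CF (fun c => nat_of_bool (all (P c) (iota 0 (N c)))).
Proof.
move=> Pc Nc.
pose S c k a := if P c k then a else 0.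
have Sc : CF (fun q : T * nat * nat => S q.1.1 q.2 q.1.2).
  apply: CF_if; [|exact/CF_fst/CF_snd|exact: CF_const].
  (* [P] does not see the accumulated value, which has to be dropped from the middle of the
     environment. *)
  have [g gK Kg] := ctx_tuple_bij T.
  have [f fc Pf] := Pc.
  have : CF (fun q : T * nat * nat => f [tuple of q.2 :: ctx_tuple q.1.1]).
    apply: CF_comp => // i; case: (unliftP ord0 i) => [j ->|->].
      under eq_fun do rewrite tnthS.
      apply: (CF_fst (F := fun q : T * nat => tnth (ctx_tuple q.1) j)).
      apply: (CF_fst (F := fun c : T => tnth (ctx_tuple c) j)).
      by exists (fun v => tnth v j); first by exists (Proj j).
    exact: CF_snd.
  by congr (CF _); apply/funext => q; rewrite (Pf (q.1.1, q.2)).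
have := CF_rec (CF_const 1) Nc Sc; congr (CF _); apply/funext => c.
elim: (N c) => [//|k IH].
rewrite -[X in iota 0 X]addn1 iotaD all_cat /= andbT -/(iota 0 k) IH /S andbC.
by case: (P c k).
Qed.

Lemma CF_has (T : ctx) (P : T -> pred nat) (N : T -> nat) :
  CF (fun q : T * nat => nat_of_bool (P q.1 q.2)) -> CF N ->
  CF (fun c => nat_of_bool (has (P c) (iota 0 (N c)))).
Proof.
move=> Pc Nc.
have := CF_not (CF_all (P := fun c k => ~~ P c k) (CF_not Pc) Nc).
congr (CF _); apply/funext => c; rewrite -has_predC; congr nat_of_bool.
by apply: eq_has => k /=; rewrite negbK.
Qed.

Lemma CF_id : CF (fun x : nat => x).
Proof. by exists (fun v => tnth v ord0); first by exists (Proj ord0). Qed.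

Lemma CF_tnth n (i : 'I_n) : CF (fun v : n.-tuple nat => tnth v i).
Proof. by exists (fun v => tnth v i); first by exists (Proj i). Qed.

(* Proves [CF (fun q => E)] by recursion on [E]; the functions and predicates
   applied in [E] are looked up in the context. *)
Ltac cf :=
  lazymatch goal with
  | |- CF (fun _ => ?k) => exact: CF_const
  | |- CF (fun q => q) => exact: CF_id
  | |- CF (fun q => tnth q ?i) => exact: CF_tnth
  | |- CF (fun q => q.2) => exact: CF_snd
  | |- CF (fun q => q.1) => exact: (CF_fst CF_id)
  | |- CF (fun q => q.1.2) => exact: (CF_fst CF_snd)
  | |- CF (fun q => q.1.1) => exact: (CF_fst (CF_fst CF_id))
  | |- CF (fun q => q.1.1.2) => exact: (CF_fst (CF_fst CF_snd))
  | |- CF (fun q => q.1.1.1) => exact: (CF_fst (CF_fst (CF_fst CF_id)))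
  | |- CF (fun q => q.1.1.1.2) =>
      exact: (CF_fst (CF_fst (CF_fst CF_snd)))
  | |- CF (fun q => q.1.1.1.1) =>
      exact: (CF_fst (CF_fst (CF_fst (CF_fst CF_id))))
  | |- CF (fun q => (@?F q).+1) => apply: (@CF_succ _ F); cf
  | |- CF (fun q => (@?F q).-1) => apply: (@CF_pred _ F); cf
  | |- CF (fun q => match @?P q with true => @?F q | false => @?N q end) =>
      apply: (@CF_if _ P F N); cf
  | |- CF (fun q => @ex_minn (@?P q) (@?exP q)) =>
      apply: (@CF_ex_minn _ P exP); cbv beta; cf
  | |- CF (fun q => nat_of_bool (~~ @?P q)) => apply: (@CF_not _ P); cf
  | |- CF (fun q => nat_of_bool (@?P q && @?Q q)) =>
      apply: (@CF_and _ P Q); cf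
  | |- CF (fun q => nat_of_bool (@?P q || @?Q q)) =>
      apply: (@CF_or _ P Q); cf
  | |- CF (fun q => nat_of_bool (@?F q <= @?N q)) =>
      apply: (@CF_leq _ F N); cf
  | |- CF (fun q => nat_of_bool (@?F q == @?N q)) =>
      apply: (@CF_eq _ F N); cf
  | |- CF (fun q => nat_of_bool (all (@?P q) (iota 0 (@?N q)))) =>
      apply: (@CF_all _ P N); cbv beta; cf
  | |- CF (fun q => nat_of_bool (has (@?P q) (iota 0 (@?N q)))) =>
      apply: (@CF_has _ P N); cbv beta; cf
  | |- _ => cf_app
  end
with cf_app :=
  match goal with
  | |- CF (fun q => nat_of_bool (?P (@?F q) (@?G q) (@?H q))) =>
      apply: (@CF_app3 _ (fun x y z => nat_of_bool (P x y z)) F G H);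
      [change (cp3 P); assumption | cf | cf | cf]
  | |- CF (fun q => nat_of_bool (?P (@?F q) (@?G q))) =>
      apply: (@CF_app2 _ (fun x y => nat_of_bool (P x y)) F G);
      [change (cp2 P); assumption | cf | cf]
  | |- CF (fun q => nat_of_bool (?P (@?F q))) =>
      apply: (@CF_app1 _ (fun x => nat_of_bool (P x)) F);
      [change (cp1 P); assumption | cf]
  | |- CF (fun q => ?f (@?F q) (@?G q) (@?H q)) =>
      apply: (@CF_app3 _ f F G H); [assumption | cf | cf | cf]
  | |- CF (fun q => ?f (@?F q) (@?G q)) =>
      apply: (@CF_app2 _ f F G); [assumption | cf | cf]
  | |- CF (fun q => ?f (@?F q)) =>
      apply: (@CF_app1 _ f F); [assumption | cf]
  end.

Lemma cf1_computable f : computable1 f <-> cf1 f.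
Proof.
split=> [fc|/CF_app1 fc].
  by exists (fun v => f (tnth v ord0)).
by apply/CF_tuple/fc/CF_tnth.
Qed.

(** The tuple of a pair [(x, y)] lists [y] first, unlike [computable2], so the variables are
    swapped. *)
Lemma cf2_computable f : computable2 f <-> cf2 f.
Proof.
split=> [/CF_comp fc|/CF_app2 fc].
  apply: (fc _ (fun q : nat * nat => [tuple q.1; q.2])).
  case=> [[|[|//]] Hi]; under eq_fun do rewrite (tnth_nth 0) /=; cf.
by apply/CF_tuple/fc; exact: CF_tnth.
Qed.

(** * Inverse of the pairing function, codes of tuples and cubes *)

Lemma inverse_pairing pr : pairing pr -> exists p1 p2,
  [/\ cf1 p1, cf1 p2, forall x y, p1 (pr x y) = x, forall x y, p2 (pr x y) = y &
      forall z, pr (p1 z) (p2 z) = z].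
Proof.
move=> [/cf2_computable prc [g gK Kg] prge].
(* Since [y <= pr x y], only [y <= z] matter, so the condition on the first component is
   decidable. *)
have ex1 (z : nat) : exists x, has (fun y => pr x y == z) (iota 0 z.+1).
  exists (g z).1; apply/hasP; exists (g z).2; last by rewrite Kg.
  by rewrite mem_iota /= ltnS -{2}(Kg z); have [] := prge (g z).1 (g z).2.
have ex2 (z : nat) : exists y, pr (ex_minn (ex1 z)) y == z.
  by case: ex_minnP => x /hasP[y _ xy] _; exists y.
have K (z : nat) : pr (ex_minn (ex1 z)) (ex_minn (ex2 z)) = z.
  by case: (ex_minnP (ex2 z)) => y /eqP.
have inj x y x' y' : pr x y = pr x' y' -> (x, y) = (x', y').
  by move=> e; apply: (can_inj gK).
exists (fun z => ex_minn (ex1 z)), (fun z => ex_minn (ex2 z)).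
have p1c : cf1 (fun z => ex_minn (ex1 z)) by rewrite /cf1; cf.
split=> //.
- apply: CF_ex_minn.
  have -> : (fun q : nat * nat =>
    nat_of_bool (pr (ex_minn (ex1 q.1)) q.2 == q.1)) =
    (fun q => nat_of_bool (pr ((fun z => ex_minn (ex1 z)) q.1) q.2 == q.1)).
    by [].
  by move: (fun z => ex_minn _) p1c => p1 p1c; cf.
- by move=> x y; have /inj[] := K (pr x y).
- by move=> x y; have /inj[] := K (pr x y).
Qed.

Section Pairing.
Variables (pr : nat -> nat -> nat) (p1 p2 : nat -> nat).
Hypotheses (prc : cf2 pr) (p1c : cf1 p1) (p2c : cf1 p2).
Hypothesis p1K : forall x y, p1 (pr x y) = x.
Hypothesis p2K : forall x y, p2 (pr x y) = y.
Hypothesis prK : forall z, pr (p1 z) (p2 z) = z.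
Hypothesis prge : forall x y, x <= pr x y /\ y <= pr x y.

(** Arities are shifted by one from here on: [tuple_code] is a bijection onto the numbers only for
    nonempty tuples. *)
Fixpoint untup n X : seq nat :=
  if n is n'.+1 then p1 X :: untup n' (p2 X) else [:: X].

Lemma size_untup n X : size (untup n X) == n.+1.
Proof. by elim: n X => [|n IH] X //=; rewrite eqSS. Qed.

Definition tdec n X : n.+1.-tuple nat := Tuple (size_untup n X).

Lemma tdecK n X : tuple_code pr (tdec n X) = X.
Proof.
rewrite /tdec /=; elim: n X => [|n IH] X //=.
case: (untup n (p2 X)) (size_untup n (p2 X)) (IH (p2 X)) => [|y s] //= _ ->.
exact: prK.
Qed.

Lemma tuple_codeK n (x : n.+1.-tuple nat) : tdec n (tuple_code pr x) = x.
Proof.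
apply: val_inj => /=; case: x => s /=; elim: n s => [|n IH] [|x s] //.
  by case: s.
rewrite eqSS => ss /=; case: s ss => [//|y s] ss.
by rewrite p1K p2K -[in RHS](IH (y :: s)).
Qed.

Lemma CF_tuple_code n : CF (fun x : n.-tuple nat => tuple_code pr x).
Proof.
(* [tuple_code] recurses on the entries, so the induction runs over a list of entry functions on a
   fixed tuple. *)
suff H (fs : seq (n.-tuple nat -> nat)) : (forall i, CF (nth (fun=> 0) fs i)) ->
    CF (fun x => tuple_code pr [seq f x | f <- fs]).
  have -> : (fun x : n.-tuple nat => tuple_code pr x) = fun x =>
      tuple_code pr [seq f x | f <- [seq (fun x => tnth x i) | i <- enum 'I_n]].
    by apply/funext => x; rewrite -map_comp map_tnth_enum.
  apply: H => i; have [ilt|ige] := ltnP i n; last first.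
    by rewrite nth_default ?size_map -?enumT ?size_enum_ord //; exact: CF_const.
  rewrite (nth_map (Ordinal ilt)) ?size_enum_ord //; exact: CF_tnth.
elim: fs => [_|f [|g fs] IH fsc] /=; [exact: CF_const|exact: fsc 0|].
apply: CF_app2 => //; first exact: fsc 0.
by apply: IH => i; exact: fsc i.+1.
Qed.

Lemma cf_tdec n (f : n.+1.-tuple nat -> nat) :
  computable f -> cf1 (fun X => f (tdec n X)).
Proof.
move/CF_comp; apply => i; under eq_fun do rewrite (tnth_nth 0) /=.
move: (nat_of_ord i) => {f}i.
elim: n i => [|n IH] [|i] /=; [exact: CF_id|exact: CF_const|exact: p1c|].
exact: CF_app1 (IH i) p2c.
Qed.

Definition incube n b X := all (fun y => y < b) (untup n X).

Lemma cp_incube n : cp2 (incube n).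
Proof.
rewrite /cp2 /cf2; elim: n => [|n IH]; rewrite /incube /=; first cf.
have {}IH : cp2 (incube n) by [].
by change (CF (fun q => (p1 q.2 < q.1) && (incube n q.1 (p2 q.2)) : nat)); cf.
Qed.

Lemma incubeP n b (x : n.+1.-tuple nat) :
  incube n b (tuple_code pr x) <-> forall i, tnth x i < b.
Proof.
rewrite /incube -[untup _ _]/(tval (tdec _ _)) tuple_codeK.
by split=> [/all_tnthP|] H; [|apply/all_tnthP] => i; apply: H.
Qed.

(** A pair bounds both its components, so no entry of a tuple exceeds its code. *)
Lemma incube_ge n b X : X < b -> incube n b X.
Proof.
rewrite /incube; elim: n X => [|n IH] X Xb /=; first by rewrite Xb.
have [] := prge (p1 X) (p2 X); rewrite prK => h1 h2.
by rewrite (leq_ltn_trans h1) ?IH // (leq_ltn_trans h2).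
Qed.

(** The codes of the points of a cube need not form an initial segment, so quantifying over them
    takes one bounded quantifier per coordinate. *)
Fixpoint allcube n b (P : pred nat) : bool :=
  if n is n'.+1 then
    all (fun x => allcube n' b (fun Y => P (pr x Y))) (iota 0 b)
  else all P (iota 0 b).

Lemma allcubeP n b P :
  allcube n b P <-> forall X, incube n b X -> P X.
Proof.
elim: n P => [|n IH] P /=; rewrite /incube /=.
  split=> [/allP H X /andP[Xb _]|H]; first by apply: H; rewrite mem_iota.
  by apply/allP => X; rewrite mem_iota /= => Xb; apply: H; rewrite Xb.
split=> [/allP H X /andP[Xb XI]|H].
  rewrite -(prK X); apply: (IH (fun Y => P (pr _ Y))).1 XI.
  by apply: H; rewrite mem_iota.
apply/allP => x; rewrite mem_iota /= => xb; apply/IH => Y Yb.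
by apply: H; rewrite p1K p2K xb.
Qed.

Lemma cp_allcube n (P : nat -> nat -> bool) :
  cp2 P -> cp2 (fun b c => allcube n b (P c)).
Proof.
elim: n P => [|n IH] P Pc; rewrite /cp2 /cf2 /=; first cf.
(* The coordinate already quantified is paired with the parameter [c], which keeps the predicate
   binary. *)
pose P' c Y := P (p1 c) (pr (p2 c) Y).
have eP c x : (fun Y => P c (pr x Y)) = P' (pr c x).
  by apply/funext => Y; rewrite /P' p1K p2K.
under eq_fun => q do under eq_all => x do rewrite eP.
have /IH Rc : cp2 P' by rewrite /cp2 /cf2 /P'; cf.
pose R b c := allcube n b (P' c).
change (CF (fun q => all (fun x => R q.1 (pr q.2 x)) (iota 0 q.1) : nat)).
by have {}Rc : cp2 R by []; cf.
Qed.

(** * Presentations of graphs and quasi-Gödel numberings *)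

(* [L t] decides which graph elements are certified by the witness [t]. *)
Definition presents n (L : nat -> pred nat) (q : pfun n.+1) :=
  forall X z, (exists t, L t (pr X z)) <-> q (tdec n X) = Some z.

Lemma graphP n (q : pfun n.+1) X z :
  graph pr q (pr X z) <-> q (tdec n X) = Some z.
Proof.
split=> [[x [y [qx /[dup] /(congr1 p1) + /(congr1 p2)]]]|qX].
  by rewrite !p1K !p2K => -> ->; rewrite tuple_codeK.
by exists (tdec n X), z; rewrite tdecK.
Qed.

Lemma egraphP n (q : pfun n.+1) X z :
  egraph pr q (pr X z.+1) <-> q (tdec n X) = Some z.
Proof.
split=> [[[y /(congr1 p2)]|[x [y [qx]]]]|qX].
- by rewrite !p2K.
- move=> /[dup] /(congr1 p1) + /(congr1 p2).
  by rewrite !p1K !p2K => -> [->]; rewrite tuple_codeK.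
- by right; exists (tdec n X), z; rewrite tdecK.
Qed.

(** The witness is the stage at which [h] lists the element; the successor skips the dummy entries
    with second component [0]. *)
Lemma QGN1_presents n (theta : nat -> pfun n.+1) : QGN1 pr theta ->
  exists2 L, cp3 L & forall i, presents (L i) (theta i).
Proof.
move=> [h /cf1_computable hc hr].
exists (fun i t w => h t == pr (pr i (p1 w)) (p2 w).+1).
  by rewrite /cp3 /cf3; cf.
move=> i X z; have := @egraphP _ (universal theta) (pr i X) z.
rewrite -hr /universal; set v := tdec _ _.
have -> : thead v = i by rewrite /v /thead (tnth_nth 0) /= p1K.
have -> : [tuple of behead v] = tdec n X by apply/val_inj; rewrite /= p2K.
move=> <-; rewrite p1K p2K; split=> [[t /eqP <-]|[t _ ht]]; first by exists t.
by exists t; apply/eqP.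
Qed.

(** To list the extended graph, a number is read as a pair of [w] and a stage. Stage [t'.+1] yields
    the graph element [w] if [L i t' w] holds; in all other cases the dummy entry at [w] is listed,
    which is always correct. *)
Lemma QGN2_presents A n (theta : nat -> pfun n.+1)
    (L : nat -> nat -> pred nat) :
  QGN2 pr A theta -> cp3 L ->
  exists2 v, cf1 v &
    forall i r, Sset A n.+1 r -> presents (L i) r -> r = theta (v i).
Proof.
move=> thetaP Lc.
pose k i q := let w := p1 q in let t := p2 q in
  if t is t'.+1 then if L i t' w then pr (p1 w) (p2 w).+1 else pr w 0
  else pr w 0.
have [|v vc hv] := thetaP k.
  apply/cf2_computable; rewrite /cf2.
  have -> : (fun q => k q.1 q.2) = fun q : nat * nat =>
      if p2 q.2 == 0 then pr (p1 q.2) 0 else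
      if L q.1 (p2 q.2).-1 (p1 q.2)
      then pr (p1 (p1 q.2)) (p2 (p1 q.2)).+1 else pr (p1 q.2) 0.
    by apply/funext => q; rewrite /k; case: (p2 q.2).
  by cf.
exists v; first exact/cf1_computable.
move=> i r Sr Lr; apply: hv => //; apply/seteqP; split=> [_ [q _ <-]|w].
  rewrite /k; set w := p1 q.
  have e0 : egraph pr r (pr w 0) by left; exists (tdec n w); rewrite tdecK.
  case: (p2 q) => [//|t]; case: ifP => // Lt.
  by apply/egraphP/Lr; exists t; rewrite prK.
case=> [[y ->]|[x [y [rx ->]]]].
  by exists (pr (tuple_code pr y) 0) => //; rewrite /k p1K p2K.
rewrite -[x]tuple_codeK in rx; have [t Lt] := (Lr _ _).2 rx.
by exists (pr (pr (tuple_code pr x) y) t.+1) => //; rewrite /k !(p1K, p2K) Lt.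
Qed.

(** * A c.e. set with non-c.e. complement; witnesses for c.e. sets *)

(* Diagonalization against [theta]: [T i t] says that [t] witnesses
   [theta_i(i) = 0]. *)
Lemma exists_nonrecursive A (theta : nat -> pfun 1) :
  quasi_Goedel_numbering pr A theta ->
  exists2 T, cp2 T & forall D, cp2 D ->
    ~ forall i, (exists t, D i t) <-> (forall t, ~~ T i t).
Proof.
move=> [thetaS /QGN1_presents[L Lc hL] _].
exists (fun i t => L i t (pr i 0)); first by rewrite /cp2 /cf2; cf.
move=> D Dc DT.
(* If [D] enumerated the complement, a parallel search for both kinds of witnesses would always
   end. *)
have ex i : exists t, D i t || L i t (pr i 0).
  have [[t Tt]|nT] := pselect (exists t, L i t (pr i 0)).
    by exists t; rewrite Tt orbT.
  have [|t Dt] := (DT i).2; last by exists t; rewrite Dt.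
  by move=> t; apply/negP => Tt; apply: nT; exists t.
(* [f] differs from [theta i] at [i]: it takes the value [1] if a witness of the value [0] is found,
   and [0] otherwise. *)
pose f i := if L i (ex_minn (ex i)) (pr i 0) then 1 else 0.
have fc : cf1 f by rewrite /cf1 /f; cf.
have [e _ he] : range theta (fun x => Some (f (tnth x ord0))).
  rewrite thetaS; left; exists (fun x => f (tnth x ord0)) => //.
  exact/cf1_computable.
have := hL e e 0; rewrite he.
have -> : tnth (tdec 0 e) ord0 = e by [].
rewrite /f; case: ex_minnP => t + _; case: ifP => [Lt _ [H _]|_].
  by have : Some 1 = Some 0 by apply: H; exists t.
rewrite orbF => Dt [_ []// s Ls].
have /DT/(_ s) : exists t, D e t by exists t.
by rewrite Ls.
Qed.

Lemma ce_presents C : ce C ->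
  exists2 Q : nat -> nat -> bool, cp2 Q & forall w, C w <-> exists t, Q t w.
Proof.
case=> [->|[f /cf1_computable fc <-]].
  exists (fun _ _ => false) => [|w]; first by rewrite /cp2 /cf2; cf.
  by split=> // -[].
exists (fun t w => f t == w) => [|w]; first by rewrite /cp2 /cf2; cf.
by split=> [[t _ <-]|[t /eqP <-]]; exists t.
Qed.

Lemma ce_exists Q : cp2 Q -> ce [set w | exists t, Q t w].
Proof.
move=> Qc; have [[w0 [t0 Q0]]|nQ] := pselect (exists w t, Q t w); last first.
  left; apply/seteqP; split=> // w [t Qt]; apply: nQ; by exists w, t.
(* Pairs that certify nothing are sent to the known element [w0]. *)
right; exists (fun q => if Q (p1 q) (p2 q) then p2 q else w0).
  by apply/cf1_computable; rewrite /cf1; cf.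
apply/seteqP; split=> [_ [q _ <-]|w [t Qt]] /=.
  by case: ifP => [Qq|_]; [exists (p1 q)|exists t0].
by exists (pr t w) => //; rewrite p1K p2K Qt.
Qed.


(** * Computable operators are Markov-computable *)

Section Operators.
Variables (sz : nat -> nat) (ent : nat -> nat -> nat) (dec : nat -> seq nat).
Hypotheses (szc : cf1 sz) (entc : cf2 ent).
Hypotheses (szE : forall a, sz a = size (dec a)).
Hypotheses (entE : forall a i, ent a i = nth 0 (dec a) i).
Variable A : set nat.

Lemma all_dec a P : all P (dec a) = all (fun j => P (ent a j)) (iota 0 (sz a)).
Proof.
have {1}-> : dec a = [seq ent a j | j <- iota 0 (sz a)].
  rewrite (eq_map (entE a)) szE; exact/esym/mkseq_nth.
by rewrite all_map.
Qed.

Lemma has_dec a P : has P (dec a) = has (fun j => P (ent a j)) (iota 0 (sz a)).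
Proof. by rewrite -[LHS]negbK -[RHS]negbK -!all_predC all_dec. Qed.

(** The witness [t] combines a stage for [Q], a code [a] of a list of graph elements, and a bound
    below which [L] has a witness for each entry. *)
Definition image_graph (Q : nat -> nat -> bool) (L : nat -> pred nat) t w :=
  Q (p1 t) (pr w (p1 (p2 t))) &&
  all (fun j => has (fun s => L s (ent (p1 (p2 t)) j)) (iota 0 (p2 (p2 t))))
    (iota 0 (sz (p1 (p2 t)))).

Lemma uniform_witness (L : nat -> pred nat) s :
  (forall u, u \in s -> exists t, L t u) ->
  exists b, all (fun u => has (fun t => L t u) (iota 0 b)) s.
Proof.
elim: s => [_|u s IH H]; first by exists 0.
have [|b Hb] := IH; first by move=> v vs; apply: H; rewrite inE vs orbT.
have [|t Lt] := H u; first exact: mem_head.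
exists (maxn b t.+1) => /=; apply/andP; split.
  by apply/hasP; exists t => //; rewrite mem_iota /= leq_max ltnSn orbT.
apply: sub_all Hb => v /hasP[x xb Lx]; apply/hasP; exists x => //.
by move: xb; rewrite !mem_iota /= leq_max => ->.
Qed.

Lemma image_presents n m (G : pfun n.+1 -> pfun m.+1) (C : set nat)
    (Q : nat -> nat -> bool) (L : nat -> pred nat) r :
  (forall w, C w <-> exists t, Q t w) ->
  graph pr (G r) = [set w | exists (y : m.+1.-tuple nat) z,
     w = pr (tuple_code pr y) z /\
     exists a, C (pr (pr (tuple_code pr y) z) a) /\
               forall u, u \in dec a -> graph pr r u] ->
  presents (n := n) L r -> presents (image_graph Q L) (G r).
Proof.
move=> CQ Gr Lr X z; rewrite -graphP Gr /=.
have gr u : graph pr r u <-> exists t, L t u.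
  by rewrite -(prK u) graphP; exact: iff_sym.
split=> [[t /andP[/= Qt]]|[y [z' [-> [a [/CQ[t Qt] Ha]]]]]].
  rewrite -(all_dec _ (fun u => has (L ^~ u) (iota 0 (p2 (p2 t))))) => /allP H.
  exists (tdec m X), z; rewrite tdecK; split=> //; exists (p1 (p2 t)).
  split; first by apply/CQ; exists (p1 t).
  by move=> u /H/hasP[s _ Ls]; apply/gr; exists s.
have [|b Hb] := @uniform_witness L (dec a); first by move=> u /Ha/gr.
exists (pr t (pr a b)); rewrite /image_graph !(p1K, p2K) Qt /=.
by rewrite -(all_dec a (fun u => has (L ^~ u) (iota 0 b))).
Qed.

Lemma total_presents n (L : nat -> pred nat) (f : n.+1.-tuple nat -> nat) :
  cp2 L -> presents L (Some \o f) -> computable f.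
Proof.
move=> Lc Lf.
(* The search runs over pairs of a value and a stage; since only the true value has a witness, the
   first hit is correct. *)
have ex X : exists s, L (p2 s) (pr X (p1 s)).
  have [_ /(_ erefl)[t Lt]] := Lf X (f (tdec n X)).
  by exists (pr (f (tdec n X)) t); rewrite p1K p2K.
have -> : f = fun x => p1 (ex_minn (ex (tuple_code pr x))).
  apply/funext => x; case: ex_minnP => s Ls _.
  have [/(_ (ex_intro (fun t => L t _) _ Ls))[] + _] :=
    Lf (tuple_code pr x) (p1 s).
  by rewrite tuple_codeK.
apply/CF_tuple; apply: (CF_app1 (f := fun X => p1 (ex_minn (ex X)))).
  by rewrite /cf1; cf.
exact: CF_tuple_code.
Qed.

(** A total function with a decidable presentation is computable; this keeps the images of [Sset]
    inside [Sset]. *)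
Lemma Shat_Sset n r : Shat A n.+1 r ->
  (exists2 L, cp2 L & presents (n := n) L r) -> Sset A n.+1 r.
Proof.
move=> [[f ->]|Ar] [L Lc Lr]; last by right.
by left; exists f => //; exact: total_presents Lr.
Qed.

Lemma Sset_Shat n : Sset A n `<=` Shat A n.
Proof. by move=> r [[f _ ->]|]; [left; exists f|right]. Qed.

Section Numberings.
Variables (n m : nat) (theta : forall i : nat, nat -> pfun i).
Hypothesis htheta :
  forall i : nat, 1 <= i -> quasi_Goedel_numbering pr A (@theta i).

Lemma cf3_section L i : cp3 L -> cp2 (L i).
Proof. by move=> Lc; rewrite /cp2 /cf2; cf. Qed.

Lemma Sset_presents k r : Sset A k.+1 r ->
  exists2 L, cp2 L & presents (n := k) L r.
Proof.
have [<- /QGN1_presents[L Lc hL] _] := @htheta k.+1 isT.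
by move=> [i _ <-]; exists (L i) => //; exact: cf3_section.
Qed.

Lemma computable_Markov (G : pfun n.+1 -> pfun m.+1) :
  set_fun (Shat A n.+1) (Shat A m.+1) G ->
  computable_operator pr dec A G ->
  set_fun (Sset A n.+1) (Sset A m.+1) G /\
  Markov_computable (@theta n.+1) (@theta m.+1) G.
Proof.
move=> GS [C /ce_presents[Q Qc CQ] GC].
have GSset : set_fun (Sset A n.+1) (Sset A m.+1) G.
  move=> r /[dup] Sr /Sset_Shat Sr'; apply: Shat_Sset; first exact: GS.
  have [L Lc Lr] := Sset_presents Sr.
  exists (image_graph Q L); last exact: (image_presents CQ (GC r Sr')).
  by rewrite /cp2 /cf2 /image_graph; cf.
split=> //.
have [thetaS /QGN1_presents[L Lc hL] _] := @htheta n.+1 isT.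
have [_ _ /QGN2_presents thetaP] := @htheta m.+1 isT.
(* The presentation of the image is uniform in [i], so (QGN II) computes an index of it from [i]. *)
have [|v vc hv] := thetaP (fun i => image_graph Q (L i)).
  by rewrite /cp3 /cf3 /image_graph; cf.
exists v => [|i]; first exact/cf1_computable.
have Si : Sset A n.+1 (@theta n.+1 i) by rewrite -thetaS; exists i.
apply: hv; first exact: GSset.
exact: image_presents CQ (GC _ (Sset_Shat Si)) (hL i).
Qed.


(** * Monotonicity and compactness of Markov-computable operators *)

Definition pfun_le k (p q : pfun k) := forall x y, p x = Some y -> q x = Some y.

Definition restrict k b (q : pfun k.+1) : pfun k.+1 :=
  fun x => if incube k b (tuple_code pr x) then q x else None.

Lemma restrict_le k b (q : pfun k.+1) : pfun_le (restrict b q) q.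
Proof. by move=> x y; rewrite /restrict; case: ifP. Qed.

Lemma incube_mono k b b' X : b <= b' -> incube k b X -> incube k b' X.
Proof. by move=> bb'; apply: sub_all => y /leq_trans; apply. Qed.

Variable fA : nat -> nat.
Hypotheses (fAc : cf1 fA) (fAr : range fA = A) (Ainf : infinite_set A).

(* Side [0] gives the empty function, which is finite even if [A] omits [0]. *)
Definition side e := if e is e'.+1 then fA e' else 0.

Lemma cf_side : cf1 side.
Proof.
have : CF (fun e : nat => if e == 0 then 0 else fA e.-1) by cf.
by congr (CF _); apply/funext => -[].
Qed.

Lemma incube0 k X : incube k 0 X = false.
Proof. by case: k. Qed.

(** Both cases of [Anf] become one, indexed by [e]: the cube of side [side 0 = 0] is empty. *)
Lemma AnfP k (q : pfun k.+1) :
  Anf A k.+1 q <->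
  exists e, forall x, q x <> None <-> incube k (side e) (tuple_code pr x).
Proof.
split=> [[d0|[a Aa da]]|[[|e] he]].
- exists 0 => x; rewrite incube0.
  by split=> // qx; have : dom q x by []; rewrite d0.
- have [e _ fe] : range fA a by rewrite fAr.
  exists e.+1 => x; rewrite /= fe incubeP.
  by rewrite -[q x <> None]/(dom q x) da.
- left; apply/seteqP; split=> // x /he; by rewrite incube0.
- right; exists (fA e); first by rewrite -fAr; exists e.
  by apply/seteqP; split=> x; [move/he/incubeP|move/incubeP/he].
Qed.

Lemma exists_side_gt t : exists e, t < fA e.
Proof.
(* Otherwise [A] would be contained in the finite set of numbers up to [t]. *)
apply/not_existsP => H; apply: Ainf.
apply: (sub_finite_set _ (finite_II t.+1)) => a.
rewrite -fAr => -[e _ <-] /=; rewrite ltnS leqNgt; exact/negP.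
Qed.

Definition above t := fA (ex_minn (exists_side_gt t)).

Lemma cf_above : cf1 above.
Proof. by rewrite /cf1 /above; cf. Qed.

Lemma above_gt t : t < above t.
Proof. by rewrite /above; case: ex_minnP. Qed.

Lemma A_above t : A (above t).
Proof. by rewrite -fAr; exists (ex_minn (exists_side_gt t)). Qed.

Variable G : pfun n.+1 -> pfun m.+1.
Hypothesis GS : set_fun (Sset A n.+1) (Sset A m.+1) G.
Hypothesis GM : Markov_computable (@theta n.+1) (@theta m.+1) G.

(** (QGN II) turns presentations into indices, [g] maps these to indices of the images, and (QGN I)
    presents the images. *)
Lemma Markov_presents (L : nat -> nat -> pred nat) (phi : nat -> pfun n.+1) :
  cp3 L -> (forall i, Sset A n.+1 (phi i)) ->
  (forall i, presents (L i) (phi i)) ->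
  exists2 D, cp3 D & forall i, presents (D i) (G (phi i)).
Proof.
move=> Lc phiS Lphi.
have [_ _ /QGN2_presents/(_ Lc)[v vc hv]] := @htheta n.+1 isT.
have [_ /QGN1_presents[D Dc hD] _] := @htheta m.+1 isT.
have [g /cf1_computable gc Gg] := GM.
exists (fun i => D (g (v i))); first by rewrite /cp3 /cf3; cf.
by move=> i; rewrite (hv i _ (phiS i) (Lphi i)) Gg.
Qed.

Lemma Markov_nonrecursive (T : nat -> pred nat) (L : nat -> nat -> pred nat)
    phi r x z :
  cp2 T ->
  (forall D, cp2 D -> ~ forall i, (exists t, D i t) <-> (forall t, ~~ T i t)) ->
  cp3 L -> (forall i, Sset A n.+1 (phi i)) ->
  (forall i, presents (L i) (phi i)) ->
  (forall i, (forall t, ~~ T i t) -> phi i = r) ->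
  G r x = Some z -> exists2 i, exists t, T i t & G (phi i) x = Some z.
Proof.
move=> Tc nonrec Lc phiS Lphi phir Grx.
have [D Dc Dphi] := Markov_presents Lc phiS Lphi.
apply: contrapT => H.
(* [D] certifies [G (phi i) x = z], which holds where [phi i = r] and by assumption fails wherever
   [T i] has a witness. *)
apply: (nonrec (fun i t => D i t (pr (tuple_code pr x) z))).
  by rewrite /cp2 /cf2; cf.
move=> i; rewrite Dphi tuple_codeK; split=> [Gi t|/phir -> //].
by apply/negP => Tt; apply: H; exists i => //; exists t.
Qed.

Lemma Markov_mono r s x z : Sset A n.+1 r -> Sset A n.+1 s -> pfun_le r s ->
  G r x = Some z -> G s x = Some z.
Proof.
move=> Sr Ss rs Grx.
have [T Tc nonrec] := exists_nonrecursive (@htheta 1 isT).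
have [Lr Lrc Lrr] := Sset_presents Sr.
have [Ls Lsc Lss] := Sset_presents Ss.
pose phi i := if `[< exists t, T i t >] then s else r.
(* The graph of [r] is always listed; a witness of [T i] releases that of [s], which is consistent
   because [s] extends [r]. *)
pose L i t w := Lr t w || T i (p1 t) && Ls (p2 t) w.
have [||||i Ti] := @Markov_nonrecursive T L phi r x z Tc nonrec _ _ _ _ Grx.
- by rewrite /cp3 /cf3 /L; cf.
- by move=> i; rewrite /phi; case: ifP.
- move=> i X y; rewrite /phi /L; case: asboolP => [[u Tu]|nT].
    split=> [[t /orP[Lt|/andP[_ Lt]]]|/Lss[t Lt]].
    + by apply/rs/Lrr; exists t.
    + by apply/Lss; exists (p2 t).
    + by exists (pr u t); rewrite p1K p2K Tu Lt orbT.
  rewrite -Lrr; split=> [[t /orP[Lt|/andP[Tt _]]]|[t Lt]]; exists t => //.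
    by case: nT; exists (p1 t).
  by rewrite Lt.
- by move=> i Ti; rewrite /phi asboolF //; case=> t; exact/negP/Ti.
- by rewrite /phi asboolT.
Qed.

(** Here [r] may be noncomputable, in which case [G r] itself carries no information. *)
Definition approx r x z :=
  exists p, [/\ Anf A n.+1 p, pfun_le p r & G p x = Some z].

Lemma Markov_compact r x z : Sset A n.+1 r -> G r x = Some z -> approx r x z.
Proof.
move=> Sr Grx; case: (Sr) => [[f fc rf]|Ar]; last by exists r; split.
have [T Tc nonrec] := exists_nonrecursive (@htheta 1 isT).
pose F X := f (tdec n X).
have Fc : cf1 F by exact: cf_tdec.
have ac := cf_above; have ic := cp_incube n.
(* As long as [T i] has no witness, stage [t] releases the arguments with code up to [t]. The first
   witness [t0] releases the cube of side [above t0], which contains all earlier arguments because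
   their codes are smaller than its side; later stages release nothing. *)
pose L i t w := [&& F (p1 w) == p2 w, ~~ has (T i) (iota 0 t) &
  if T i t then incube n (above t) (p1 w) else p1 w <= t].
have Lc : cp3 L.
  have {1}-> : L = fun i t w => (F (p1 w) == p2 w) &&
    (~~ has (fun u => T i u) (iota 0 t) &&
    ((T i t && incube n (above t) (p1 w)) || (~~ T i t && (p1 w <= t)))).
    do 3![apply/funext => ?]; rewrite /L; congr [&& _, _ & _].
    by case: (T _ _); rewrite /= ?orbF.
  by rewrite /cp3 /cf3; cf.
have /choice[phi hphi] : forall i, exists q, [/\ Sset A n.+1 q,
    presents (L i) q, (forall t, ~~ T i t) -> q = r &
    (exists t, T i t) -> Anf A n.+1 q /\ pfun_le q r].
  move=> i; have [Ti|nT] := pselect (exists t, T i t); last first.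
    have nTi t : ~~ T i t by apply/negP => Tt; apply: nT; exists t.
    exists r; split=> // X y; rewrite rf /L /=.
    split=> [[t /andP[]]|[<-]]; first by rewrite p1K p2K => /eqP <-.
    exists X; rewrite p1K p2K eqxx (negPf (nTi _)) leqnn andbT /=.
    by apply/hasPn => u _.
  pose t0 := ex_minn Ti.
  have [Tt0 t0min] : T i t0 /\ forall u, T i u -> t0 <= u.
    by rewrite /t0; case: ex_minnP.
  have Aq : Anf A n.+1 (restrict (above t0) r).
    right; exists (above t0); first exact: A_above.
    apply/seteqP; split=> y; rewrite /dom /restrict /= -(@incubeP n) rf /=.
      by case: ifP.
    by move=> ->.
  exists (restrict (above t0) r); split=> //.
  - by right.
  - move=> X y; rewrite /restrict tdecK rf /L; split=> [[t]|].
      rewrite !(p1K, p2K) => /and3P[/eqP <- /hasPn nT].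
      case: ifP => [Tt Xt|nTt Xt].
        have tt0 : t = t0.
          apply/eqP; rewrite eqn_leq t0min // andbT leqNgt; apply/negP => t0t.
          by have := nT t0; rewrite mem_iota /= Tt0 => /(_ t0t).
        by rewrite -tt0 Xt.
      have tt0 : t < t0.
        rewrite ltnNge; apply/negP; rewrite leq_eqVlt => /orP[/eqP t0t|t0t].
          by rewrite t0t nTt in Tt0.
        by have := nT t0; rewrite mem_iota /= Tt0 => /(_ t0t).
      rewrite incube_ge //; apply: leq_ltn_trans Xt _.
      exact: ltn_trans tt0 (above_gt _).
    case: ifP => // Xt [<-]; exists t0.
    rewrite !(p1K, p2K) eqxx Tt0 Xt andbT /=.
    apply/hasPn => u; rewrite mem_iota /= add0n => ut.
    by apply/negP => /t0min; rewrite leqNgt ut.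
  - by move=> /(_ t0); rewrite Tt0.
  - by split=> //; exact: restrict_le.
have [||||i Ti Gi] :=
  @Markov_nonrecursive T L phi r x z Tc nonrec _ _ _ _ Grx => //;
  try by move=> i; have [] := hphi i.
by have [_ _ _ /(_ Ti)[? ?]] := hphi i; exists (phi i).
Qed.

(** * The extension of the operator to all total functions *)

(** Two finite functions below [r] have nested domains and agree on the smaller one, so one extends
    the other and monotonicity applies. *)
Lemma approx_uniq r x z z' : approx r x z -> approx r x z' -> z = z'.
Proof.
move=> [p [Ap pr_ Gp]] [p' [Ap' pr' Gp']].
have [e he] := (AnfP _).1 Ap; have [e' he'] := (AnfP _).1 Ap'.
wlog ee' : p p' e e' z z' Ap pr_ Gp he Ap' pr' Gp' he' / side e <= side e'.
  move=> W; have [ee'|/ltnW ee'] := leqP (side e) (side e').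
    exact: (W p p' e e').
  exact/esym/(W p' p e' e).
have pp' : pfun_le p p'.
  move=> y u py.
  have : p' y <> None by apply/he'/(incube_mono ee')/he; rewrite py.
  case p'y : (p' y) => [u'|//] _.
  by have := pr' _ _ p'y; rewrite (pr_ _ _ py).
have := Markov_mono (or_intror Ap) (or_intror Ap') pp' Gp.
by rewrite Gp' => -[].
Qed.

Definition extension (r : pfun n.+1) : pfun m.+1 := fun x =>
  if pselect (exists z, approx r x z) is left H then Some (projT1 (cid H))
  else None.

Lemma extensionP r x z : extension r x = Some z <-> approx r x z.
Proof.
rewrite /extension; case: pselect => [H|nH].
  case: cid => y /= ry; split=> [[<-] //|rz]; congr Some; exact: approx_uniq rz.
by split=> // rz; case: nH; exists z.
Qed.

(** Compactness gives one inclusion of the graphs, monotonicity the other. *)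
Lemma extensionE r : Sset A n.+1 r -> extension r = G r.
Proof.
move=> Sr; apply/funext => x; case Grx : (G r x) => [z|].
  exact/extensionP/Markov_compact.
case ex : (extension r x) => [z|//].
have /extensionP[p [Ap pr_ Gp]] := ex.
by have := Markov_mono (or_intror Ap) Sr pr_ Gp; rewrite Grx.
Qed.

(* The domains of the [G p], for finite [p] below [r], are cubes; hence their
   union is a cube or everything. *)
Lemma extension_Shat r : Shat A m.+1 (extension r).
Proof.
have [tot|] := pselect (forall x, extension r x <> None).
  left; exists (fun x => odflt 0 (extension r x)); apply/funext => x /=.
  by case: (extension r x) (tot x).
move=> /existsNP[x0 /contrapT ex0]; right.
(* A total [G p] would make the extension defined at [x0]. *)
have GAnf p : Anf A n.+1 p -> pfun_le p r -> Anf A m.+1 (G p).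
  move=> Ap pr_; case: (GS (or_intror Ap : Sset A n.+1 p)) => // -[f _ Gf].
  have : extension r x0 = Some (f x0).
    by apply/extensionP; exists p; split=> //; rewrite Gf.
  by rewrite ex0.
pose D b := `[< exists e p, [/\ b = side e, Anf A n.+1 p, pfun_le p r &
  forall x, G p x <> None <-> incube m b (tuple_code pr x)] >].
have exD : exists b, D b.
  have A0 : Anf A n.+1 (fun=> None) by left; apply/seteqP; split.
  have r0 : pfun_le (fun=> None) r by [].
  have [e he] := (AnfP _).1 (GAnf _ A0 r0).
  by exists (side e); apply/asboolP; exists e, (fun=> None).
(* A cube whose side exceeds the code of [x0] contains [x0]. So the sides are bounded, and the
   largest cube is the domain of the extension. *)
have Dle b : D b -> b <= tuple_code pr x0.
  move=> /asboolP[e [p [_ Ap pr_ Hp]]]; rewrite leqNgt; apply/negP.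
  move=> /(@incube_ge m)/Hp; case Gp : (G p x0) => [z|//] _.
  have /extensionP : approx r x0 z by exists p; split.
  by rewrite ex0.
have [b /asboolP[e [p [be Ap pr_ Hp]]] bmax] := ex_maxnP exD Dle.
apply/AnfP; exists e => x; rewrite -be; split=> [|/Hp].
  case ex : (extension r x) => [z|//] _.
  have /extensionP[p' [Ap' pr' Gp']] := ex.
  have [e' he'] := (AnfP _).1 (GAnf _ Ap' pr').
  apply: (@incube_mono _ (side e')); last by apply/he'; rewrite Gp'.
  by apply: bmax; apply/asboolP; exists e', p'.
case Gp : (G p x) => [z|//] _.
by have /extensionP -> : approx r x z by exists p; split.
Qed.

(** * Computability of the extension *)

Definition covers a X := has (fun u => p1 u == X) (dec a).

(** The first disjunct makes the search total, with value [0] where the list has no entry. *)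
Lemma exists_value a X : exists v, ~~ covers a X || (pr X v \in dec a).
Proof.
case: (boolP (covers a X)) => [/hasP[u ua /eqP <-]|_]; last by exists 0.
by exists (p2 u); rewrite prK ua.
Qed.

Definition value a X := ex_minn (exists_value a X).

Lemma value_covers a X : covers a X -> pr X (value a X) \in dec a.
Proof. by rewrite /value; case: ex_minnP => v + _ c; rewrite c. Qed.

Lemma cp_covers : cp2 covers.
Proof. by rewrite /cp2 /cf2 /covers; under eq_fun do rewrite has_dec; cf. Qed.

Lemma cf_value : cf2 value.
Proof.
rewrite /cf2 /value; have cc := cp_covers.
apply: (CF_ex_minn
  (P := fun q v => ~~ covers q.1 q.2 || (pr q.2 v \in dec q.1))).
have -> : (fun q : nat * nat * nat =>
    nat_of_bool (~~ covers q.1.1 q.1.2 || (pr q.1.2 q.2 \in dec q.1.1))) =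
  (fun q => nat_of_bool (~~ covers q.1.1 q.1.2 ||
    has (fun j => ent q.1.1 j == pr q.1.2 q.2) (iota 0 (sz q.1.1)))).
  by apply/funext => q; rewrite -has_pred1 has_dec.
by cf.
Qed.

(* [pr a e] codes the function on the cube of side [side e] whose values are
   read off the list [dec a] of graph elements; the values are junk where the
   list has no entry. *)
Definition finite_pfun c : pfun n.+1 := fun x =>
  let X := tuple_code pr x in
  if incube n (side (p2 c)) X then Some (value (p1 c) X) else None.

Lemma finite_pfun_Anf c : Anf A n.+1 (finite_pfun c).
Proof.
by apply/AnfP; exists (p2 c) => x; rewrite /finite_pfun /=; case: ifP.
Qed.

(** The points of the cube are enumerated as the elements of the finite type of functions from
    ['I_k.+1] to ['I_b]. *)
Lemma graph_list k b (f : k.+1.-tuple nat -> nat) :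
  exists s : seq nat,
    forall X v, pr X v \in s <-> incube k b X /\ f (tdec k X) = v.
Proof.
have [x xE] : exists x : {ffun 'I_k.+1 -> 'I_b} -> k.+1.-tuple nat,
    forall u i, tnth (x u) i = u i.
  exists (fun u => [tuple nat_of_ord (u i) | i < k.+1]) => u i.
  exact: tnth_mktuple.
exists [seq pr (tuple_code pr (x u)) (f (x u)) | u <- enum {: {ffun _ -> _}}].
move=> X v; split.
  move=> /mapP[u _ /= /[dup] /(congr1 p1) + /(congr1 p2)].
  rewrite !p1K !p2K => -> ->; rewrite tuple_codeK; split=> //.
  by apply/incubeP => i; rewrite xE.
rewrite -{1}(tdecK k X) => -[/incubeP Xb <-].
apply/mapP; exists [ffun i => Ordinal (Xb i)]; first by rewrite mem_enum.
suff -> : x [ffun i => Ordinal (Xb i)] = tdec k X by rewrite tdecK.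
by apply: eq_from_tnth => i; rewrite xE ffunE.
Qed.

Hypothesis dec_surj : forall s, exists a, dec a = s.

Lemma extension_computable : computable_operator pr dec A extension.
Proof.
have sc := cf_side; have vc := cf_value; have cc := cp_covers.
have ic := cp_incube n.
pose L c (t : nat) w :=
  incube n (side (p2 c)) (p1 w) && (value (p1 c) (p1 w) == p2 w).
have Lc : cp3 L by rewrite /cp3 /cf3 /L; cf.
have [|c X z|D Dc hD] := Markov_presents (phi := finite_pfun) Lc.
- by move=> c; right; exact: finite_pfun_Anf.
- rewrite /L /finite_pfun tdecK !(p1K, p2K).
  split=> [[_ /andP[-> /eqP ->]] //|].
  by case: ifP => // _ [->]; exists 0; rewrite eqxx.
pose cover_all b a := allcube n b (covers a).
have ca : cp2 cover_all by exact: cp_allcube.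
(* [w] pairs a graph element with a list code [a], and [t] pairs [e] with a stage. The list must
   cover the cube of side [side e], so that no junk value is used, and [D] must certify the element
   for [G] at the function coded by [pr a e]. *)
pose Q t w := cover_all (side (p1 t)) (p2 w) &&
  D (pr (p2 w) (p1 t)) (p2 t) (p1 w).
have Qc : cp2 Q by rewrite /cp2 /cf2 /Q; cf.
exists [set w | exists t, Q t w]; first exact: ce_exists.
move=> r _; apply/seteqP; split=> w.
  rewrite -(prK w) => /graphP/extensionP[p [/AnfP[e he] pr_ Gp]].
  exists (tdec m (p1 w)), (p2 w); rewrite !tdecK; split=> //.
  (* The default value [0] never enters the list below, which only runs over the domain of [p]. *)
  have [f fE] : exists f, forall x, p x <> None -> p x = Some (f x).
    exists (fun x => odflt 0 (p x)) => x; by case: (p x).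
  have [s sP] := graph_list (side e) f.
  have [a as_] := dec_surj s.
  have pE : finite_pfun (pr a e) = p.
    apply/funext => x; rewrite /finite_pfun !(p1K, p2K); case: ifP => [xe|xe].
      have px := fE x ((he x).2 xe); rewrite px; congr Some.
      have ax : pr (tuple_code pr x) (f x) \in dec a.
        by rewrite as_; apply/sP; rewrite tuple_codeK.
      have /value_covers : covers a (tuple_code pr x).
        by apply/hasP; exists (pr (tuple_code pr x) (f x)); rewrite ?p1K.
      by rewrite as_ => /sP[_]; rewrite tuple_codeK.
    by have := (he x).1; rewrite xe; case: (p x) => // u [].
  exists a; split=> [|u].
    have [_] := hD (pr a e) (p1 w) (p2 w); rewrite pE => /(_ Gp)[t Dt].
    exists (pr e t); rewrite /Q !(p1K, p2K) Dt andbT; apply/allcubeP => X Xe.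
    apply/hasP; exists (pr X (f (tdec n X))); rewrite ?p1K // as_.
    exact/sP.
  rewrite as_ -(prK u) => /sP[ue fu]; apply/graphP/pr_; rewrite -fu.
  by apply/fE/he; rewrite tdecK.
(* Conversely, the values on the covered cube are read off entries in the graph of [r], so the coded
   finite function lies below [r]. *)
move=> [y [z [-> [a [[t /andP[+ +]] Ha]]]]]; rewrite !(p1K, p2K).
move=> /allcubeP cov Dt.
apply/graphP/extensionP; exists (finite_pfun (pr a (p1 t))); split.
- exact: finite_pfun_Anf.
- move=> x v; rewrite /finite_pfun !(p1K, p2K); case: ifP => // /cov.
  by move=> /value_covers/Ha/graphP; rewrite tuple_codeK => + [<-].
- by apply/hD; exists (p2 t).
Qed.

End Numberings.
End Operators.
End Pairing.

(** * Both directions for arbitrary positive arities *)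

Theorem theorem7p7
    (pr : nat -> nat -> nat) (hpr : pairing pr)
    (dec : nat -> seq nat) (hdec : effective_coding dec)
    (A : set nat) (hAinf : infinite_set A) (hAce : ce A)
    (n m : nat) (hn : 1 <= n) (hm : 1 <= m)
    (theta : forall i : nat, nat -> pfun i)
    (htheta : forall i : nat, 1 <= i ->
       quasi_Goedel_numbering pr A (theta i)) :
  (forall Ghat : pfun n -> pfun m,
     set_fun (Shat A n) (Shat A m) Ghat ->
     computable_operator pr dec A Ghat ->
     set_fun (Sset A n) (Sset A m) Ghat /\
     Markov_computable (theta n) (theta m) Ghat)
  /\
  (forall G : pfun n -> pfun m,
     set_fun (Sset A n) (Sset A m) G ->
     Markov_computable (theta n) (theta m) G ->
     exists Ghat : pfun n -> pfun m,
       [/\ set_fun (Shat A n) (Shat A m) Ghat,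
           computable_operator pr dec A Ghat
         & forall r : pfun n, Sset A n r -> Ghat r = G r]).
Proof.
have [p1 [p2 [p1c p2c p1K p2K prK]]] := inverse_pairing hpr.
have [/cf2_computable prc _ prge] := hpr.
have [dec_bij /cf1_computable szc /cf2_computable entc _] := hdec.
have dec_surj s : exists a, dec a = s.
  by have [g _ decK] := dec_bij; exists (g s).
case: n hn => [//|n'] _; case: m hm => [//|m'] _.
split=> [G GS GC|G GS GM].
  exact: (computable_Markov prc p1c p2c p1K p2K prK szc entc
    (fun _ => erefl) (fun _ _ => erefl) htheta GS GC).
(* An infinite set is nonempty, so [A] is the range of a computable function. *)
have [fA fAc fAr] : exists2 fA, cf1 fA & range fA = A.
  case: hAce => [A0|[f /cf1_computable fc fA]]; last by exists f.
  by case: hAinf; rewrite A0.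
exists (extension A G); split.
- move=> r _; exact: (extension_Shat prc p1c p2c p1K p2K prK prge
    htheta fAr GS GM).
- exact: (extension_computable prc p1c p2c p1K p2K prK szc entc
    (fun _ => erefl) (fun _ _ => erefl) htheta fAc fAr GM dec_surj).
- move=> r; exact: (extensionE prc p1c p2c p1K p2K prK prge
    htheta fAc fAr hAinf GM).
Qed.
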